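(* Let $A\subset \mathbb{R}^p$ be a self-similar fractal defined by similitudes $\{\psi_m\}_{m=1}^M$ with contraction ratios $\{r_m\}_{m=1}^M$, and let $d$ be the Hausdorff dimension of $A$. Assume that there are $r\in(0,1)$ and positive integers $i_1,\ldots,i_M$ such that $r_k=r^{i_k}$ for every $k=1,\ldots,M$. Then the limit $$\lim_{N\to\infty}\delta(A,N)N^{1/d}$$ does not exist. Therefore, for all sufficiently large $s$, the limit $$\lim_{N\to\infty}\frac{\mathcal{E}_s(A,N)}{N^{1+s/d}}$$ does not exist.
   Context: A similitude with contraction ratio $0<\rho<1$ is a map $\psi:\mathbb{R}^p\to\mathbb{R}^p$ of the form $\psi(x)=\rho\, O(x)+z$ with $O$ an orthogonal $p\times p$ matrix and $z\in\mathbb{R}^p$. A (nonempty) compact set $A\subset\mathbb{R}^p$ is a self-similar fractal defined by similitudes $\{\psi_m\}_{m=1}^M$ ($M\geq 2$) with contraction ratios $\{r_m\}_{m=1}^M$ if $A=\bigcup_{m=1}^M\psi_m(A)$, where the union is disjoint (the sets $\psi_m(A)$ are pairwise disjoint). The Hausdorff dimension $d$ of such $A$ is the number satisfying $\sum_{m=1}^M r_m^d=1$. For an integer $N\geq 2$, the best-packing distance is $$\delta(A,N):=\sup_{\omega_N}\min_{i\neq j}|x_i-x_j|,$$ and for $s>0$ the minimal discrete Riesz $s$-energy is $$\mathcal{E}_s(A,N):=\inf_{\omega_N}\sum_{i\neq j}|x_i-x_j|^{-s},$$ where the supremum and infimum are over all sets $\omega_N=\{x_1,\ldots,x_N\}\subset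 A$ of $N$ distinct points, the sum is over ordered pairs $(i,j)$ with $i\neq j$, and $|\cdot|$ is the Euclidean norm. *)

(* Defs.v *)
From HB Require Import structures.
From mathcomp Require Import all_boot all_order all_algebra.
From mathcomp Require Import all_classical all_reals all_analysis.

Set Implicit Arguments.
Unset Strict Implicit.
Unset Printing Implicit Defensive.
Import Order.TTheory GRing.Theory Num.Theory.
Import numFieldNormedType.Exports.
Local Open Scope classical_set_scope.
Local Open Scope ring_scope.

(* The library norm [`|x|] on ['rV[R]_p] is the sup norm.  The two norms induce
   the same topology, so the library's [compact] is compactness in R^p. *)
Definition enorm (R : realType) (p : nat) (x : 'rV[R]_p) : R :=
  Num.sqrt (\sum_(k < p) (x ord0 k) ^+ 2).

Definition orthogonalmx (R : realType) (p : nat) (O : 'M[R]_p) : Prop :=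
  O *m O^T = 1%:M.

(* Points are row vectors, so [x *m O] is the image of x under the orthogonal
   matrix [O^T]; [O] ranges over all orthogonal matrices. *)
Definition similitude (R : realType) (p : nat) (rho : R)
    (psi : 'rV[R]_p -> 'rV[R]_p) : Prop :=
  0 < rho < 1 /\
  exists (O : 'M[R]_p) (z : 'rV[R]_p),
    orthogonalmx O /\ forall x, psi x = rho *: (x *m O) + z.

Definition self_similar_fractal (R : realType) (p M : nat)
    (psi : 'I_M -> 'rV[R]_p -> 'rV[R]_p) (r : 'I_M -> R)
    (A : set 'rV[R]_p) : Prop :=
  [/\ (2 <= M)%N,
      forall m, similitude (r m) (psi m),
      A !=set0 /\ compact A,
      A = \bigcup_m (psi m @` A) &
      trivIset setT (fun m => psi m @` A)].

(* For M >= 2 and ratios in ]0, 1[ there is exactly one such d, and d > 0. *)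
Definition similarity_dimension (R : realType) (M : nat) (r : 'I_M -> R)
    (d : R) : Prop :=
  \sum_(m < M) r m `^ d = 1.

(* An N-point subset of A, given by an (injective) enumeration. *)
Definition configuration (R : realType) (p : nat) (A : set 'rV[R]_p) (N : nat)
    (x : 'I_N -> 'rV[R]_p) : Prop :=
  injective x /\ forall i, A (x i).

(* The default value +oo only matters when there is no pair i != j,
   that is for N < 2. *)
Definition separation (R : realType) (p N : nat) (x : 'I_N -> 'rV[R]_p)
    : \bar R :=
  \big[mine/+oo%E]_(i < N) \big[mine/+oo%E]_(j < N | i != j)
    (enorm (x i - x j))%:E.

Definition best_packing (R : realType) (p : nat) (A : set 'rV[R]_p) (N : nat)
    : \bar R :=
  ereal_sup [set separation x | x in @configuration R p A N].

Definition riesz_energy (R : realType) (p N : nat) (s : R)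
    (x : 'I_N -> 'rV[R]_p) : R :=
  \sum_(i < N) \sum_(j < N | i != j) enorm (x i - x j) `^ (- s).

Definition min_riesz_energy (R : realType) (p : nat) (s : R)
    (A : set 'rV[R]_p) (N : nat) : \bar R :=
  ereal_inf [set (riesz_energy s x)%:E | x in @configuration R p A N].

(* Main.v *)
(* Let P(t) be the largest number of points of A with pairwise distances > t.
   The pieces psi_m(A) are at positive distance, so P(t) = \sum_m P(t / r_m) for
   small t.  Hence u_k = P(r^k t) (r^k t)^d solves the renewal equation
   u_n = \sum_m r_m^d u_(n - i_m), for which
   Q = \sum_m r_m^d (u_(n - i_m) + ... + u_(n - 1)) is independent of n.
   If delta(A, N) N^(1/d) tends to L, then u_k tends to L^d for every t, so Q is
   the same number for all small t.  But Q is t^d times a combination of values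
   of the integer-valued monotone function P, all of which are constant in t on
   some interval: a contradiction.

   For the energy, take 0 < a < b such that delta(A, N) N^(1/d) is < a infinitely
   often and > b infinitely often.  A configuration of N points with separation
   > b N^(-1/d) has energy O(b^-s) N^(1 + s/d), with a constant independent of s,
   so that a limit of the normalized energy is O(b^-s).  Conversely, if
   delta(A, n) n^(1/d) < a and N is slightly larger than n, then a positive
   proportion of the points of any N-point configuration have potential at least
   (a n^(-1/d))^-s, so that the limit is at least a constant times a'^-s, for an
   a' in ]a, b[.  This is impossible for large s. *)
Require Import Defs.
From HB Require Import structures.
From mathcomp Require Import all_boot all_order all_algebra.
From mathcomp Require Import all_classical all_reals all_analysis.
From mathcomp Require Import ring lra.

Set Implicit Arguments.
Unset Strict Implicit.
Unset Printing Implicit Defensive.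
Import Order.TTheory GRing.Theory Num.Theory.
Import numFieldNormedType.Exports.
Local Open Scope classical_set_scope.
Local Open Scope ring_scope.

Section EuclideanNorm.
Variables (R : realType) (p : nat).
Implicit Types x y : 'rV[R]_p.

Lemma enorm_sqr x : enorm x ^+ 2 = \sum_(k < p) x ord0 k ^+ 2.
Proof. by rewrite sqr_sqrtr// sumr_ge0// => k _; rewrite sqr_ge0. Qed.

Lemma enorm_ge0 x : 0 <= enorm x. Proof. exact: sqrtr_ge0. Qed.

Lemma enorm0 : enorm (0 : 'rV[R]_p) = 0.
Proof.
by rewrite /enorm big1 ?sqrtr0// => k _; rewrite mxE expr0n.
Qed.

Lemma coord_le_enorm x k : `|x ord0 k| <= enorm x.
Proof.
rewrite -(@ler_pXn2r _ 2) ?nnegrE ?enorm_ge0 ?normr_ge0//.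
rewrite enorm_sqr real_normK ?num_real// (bigD1 k)//= lerDl.
by rewrite sumr_ge0// => j _; rewrite sqr_ge0.
Qed.

Lemma norm_le_enorm x : `|x| <= enorm x.
Proof.
rewrite [`|x|]mx_normrE; apply: bigmax_le; first exact: enorm_ge0.
by move=> [a k] _ /=; rewrite ord1; exact: coord_le_enorm.
Qed.

Lemma coord_le_norm x k : `|x ord0 k| <= `|x|.
Proof.
rewrite [`|x|]mx_normrE.
exact: (le_bigmax _ (fun ij => `|x ij.1 ij.2|) (ord0, k)).
Qed.

Lemma enorm_le_coord x (c : R) : 0 <= c -> (forall k, `|x ord0 k| <= c) ->
  enorm x ^+ 2 <= p%:R * c ^+ 2.
Proof.
move=> c0 xc; rewrite enorm_sqr.
have -> : p%:R * c ^+ 2 = \sum_(k < p) c ^+ 2.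
  by rewrite sumr_const card_ord mulr_natl.
apply: ler_sum => k _; rewrite -real_normK ?num_real//.
by rewrite lerXn2r ?nnegrE.
Qed.

Lemma enorm_orthogonal x (O : 'M[R]_p) : orthogonalmx O ->
  enorm (x *m O) = enorm x.
Proof.
have E y : enorm y = Num.sqrt ((y *m y^T) ord0 ord0).
  by congr Num.sqrt; rewrite mxE; apply: eq_bigr => k _; rewrite mxE expr2.
move=> OO; rewrite !E; congr (Num.sqrt (fun_of_matrix _ _ _)).
by rewrite trmx_mul mulmxA -(mulmxA x) OO mulmx1.
Qed.

Lemma enorm_similitude (rho : R) psi x y : similitude rho psi ->
  enorm (psi x - psi y) = rho * enorm (x - y).
Proof.
case=> /andP[rho0 _] [ O [z [OO psiE]]]; rewrite !psiE.
rewrite opprD addrACA subrr addr0 -scalerBr -mulmxBl -(enorm_orthogonal (x - y) OO).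
move: (_ *m O) => v; rewrite /enorm.
under eq_bigr do rewrite mxE exprMn.
by rewrite -mulr_sumr sqrtrM ?sqr_ge0// sqrtr_sqr gtr0_norm.
Qed.

Lemma similitude_continuous (rho : R) (psi : 'rV[R]_p -> 'rV[R]_p) :
  similitude rho psi -> continuous psi.
Proof.
move=> psiS x; have [/andP[rho0 rho1] _] := psiS.
apply/(@cvgrPdist_le _ _ _ (nbhs x)) => e e0.
have c0 : (0 : R) < p%:R + 1 by rewrite ltr_wpDl.
near=> y; apply: (le_trans (norm_le_enorm _)).
rewrite (enorm_similitude _ _ psiS).
have : `|x - y| <= e / (p%:R + 1).
  near: y; apply: cvgr_dist_le => //; rewrite divr_gt0//.
set c := _ / _ => yc.
have ce : 0 <= c by rewrite divr_ge0// ltW.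
have := @enorm_le_coord (x - y) c ce (fun k => le_trans (coord_le_norm _ k) yc).
move=> H; apply: (@le_trans _ _ (enorm (x - y))).
  by rewrite ler_piMl ?enorm_ge0// ltW.
rewrite -(@ler_pXn2r _ 2) ?nnegrE ?enorm_ge0 ?(ltW e0)//.
apply: (le_trans H); rewrite /c expr_div_n mulrCA ler_piMr ?sqr_ge0//.
rewrite ler_pdivrMr ?mul1r ?exprn_gt0//.
have : (0 : R) <= p%:R by [].
nra.
Unshelve. all: by end_near. Qed.

End EuclideanNorm.

Lemma compact_disjoint_gap (R : realType) (p : nat) (K L : set 'rV[R]_p) :
  compact K -> compact L -> K `&` L = set0 ->
  exists2 h : R, 0 < h & forall x y, K x -> L y -> h <= enorm (x - y).
Proof.
move=> cK cL KL0.
have [->|/set0P[x0 Kx0]] := eqVneq K set0; first by exists 1.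
have [->|/set0P[y0 Ly0]] := eqVneq L set0; first by exists 1.
pose f (z : 'rV[R]_p * 'rV[R]_p) := `|z.1 - z.2|.
have cf : continuous f.
  by move=> z; apply: cvg_norm; apply: cvgB; [exact: cvg_fst|exact: cvg_snd].
have [|||[x y] /set_mem[/= Kx Ly] xymin] := @compact_EVT_min _ R f (K `*` L).
- by exists (x0, y0).
- exact: compact_setX.
- exact: continuous_subspaceT.
exists (f (x, y)).
  rewrite /f/= normr_gt0 subr_eq0; apply/eqP => xy.
  have : (K `&` L) x by split => //; rewrite xy.
  by rewrite KL0.
move=> u v Ku Lv; apply: le_trans (norm_le_enorm _).
by apply: (xymin (u, v)); rewrite inE.
Qed.

Lemma sum_inv_sqr_le2 (R : realFieldType) (n : nat) :
  \sum_(c < n) (1 + c%:R)^-1 ^+ 2 <= 2 :> R.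
Proof.
suff: \sum_(c < n.+1) (1 + c%:R)^-1 ^+ 2 <= 2 - (1 + n%:R)^-1 :> R.
  rewrite big_ord_recr/= => H.
  have c0 : (0 : R) < 1 + n%:R by rewrite ltr_pwDl.
  have := sqr_ge0 ((1 + n%:R)^-1 : R); have : 0 < (1 + n%:R)^-1 :> R.
    by rewrite invr_gt0.
  lra.
elim: n => [|n IH]; first by rewrite big_ord1 addr0 invr1 expr1n; lra.
rewrite big_ord_recr/= (le_trans (lerD IH (lexx _)))//.
have n0 : (0 : R) <= n%:R by [].
set a := n%:R in n0 *; have -> : n.+1%:R = 1 + a by rewrite -natr1 addrC.
rewrite -subr_ge0.
have a1 : 1 + a != 0 by rewrite gt_eqF// ltr_pwDl.
have a2 : 1 + (1 + a) != 0 by rewrite gt_eqF// ltr_pwDl// addr_ge0.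
have -> : 2 - (1 + (1 + a))^-1 - (2 - (1 + a)^-1 + (1 + (1 + a))^-1 ^+ 2)
    = (1 + a)^-1 * (1 + (1 + a))^-1 ^+ 2 by field; rewrite a1 a2.
by rewrite mulr_ge0 ?sqr_ge0// invr_ge0 addr_ge0.
Qed.

Lemma sum_inj_le (R : numDomainType) (I J : finType) (P : pred I)
    (phi : I -> J) (F : J -> R) :
  injective phi -> (forall j, 0 <= F j) ->
  \sum_(i | P i) F (phi i) <= \sum_j F j.
Proof.
move=> phiI F0; rewrite -(big_imset _ (in2W phiI))/=.
rewrite [leLHS]big_mkcond; apply: ler_sum => j _.
by case: ifP.
Qed.

Lemma lattice_sum_le (R : realFieldType) (p : nat) (J : finType) (P : pred J)
    (m : J -> 'I_p -> int) :
  (forall j j', m j =1 m j' -> j = j') ->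
  \sum_(j | P j) \prod_(k < p) (1 + `|m j k|%N%:R)^-1 ^+ 2 <= 4 ^+ p :> R.
Proof.
move=> mI.
pose B := \max_(j : J) \max_(k < p) `|m j k|%N.
have mB j k : (`|m j k| < B.+1)%N.
  rewrite ltnS; apply: leq_trans (leq_bigmax j).
  exact: (leq_bigmax (F := fun k => `|m j k|%N)).
pose phi j : {ffun 'I_p -> bool * 'I_B.+1} :=
  [ffun k => (m j k < 0, Ordinal (mB j k))].
have phiI : injective phi.
  move=> j j' /ffunP jj; apply: mI => k.
  move: (jj k); rewrite !ffunE => -[s a].
  by rewrite [LHS]intEsign [RHS]intEsign s a.
pose G (q : bool * 'I_B.+1) : R := (1 + q.2%:R)^-1 ^+ 2.
have -> : \sum_(j | P j) \prod_(k < p) (1 + `|m j k|%N%:R)^-1 ^+ 2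
    = \sum_(j | P j) \prod_(k < p) G (phi j k) :> R.
  by apply: eq_bigr => j _; apply: eq_bigr => k _; rewrite ffunE.
apply: (le_trans (@sum_inj_le _ _ _ P phi (fun f => \prod_k G (f k)) phiI _)).
  by move=> f; apply: prodr_ge0 => k _; rewrite sqr_ge0.
rewrite -(bigA_distr_bigA (fun _ => G))/= prodr_const card_ord.
rewrite lerXn2r ?nnegrE ?sumr_ge0//; first by move=> *; rewrite sqr_ge0.
rewrite -(pair_bigA _ (fun b c => G (b, c)))/= big_bool/=.
have := sum_inv_sqr_le2 R B.+1; lra.
Qed.

Definition shell_const (R : realType) (p : nat) : R :=
  (p%:R + 3) ^+ (2 * p) * 4 ^+ p.

Lemma shell_const_ge0 (R : realType) p : 0 <= shell_const R p.
Proof. by rewrite mulr_ge0// exprn_ge0// addr_ge0. Qed.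

(* The points lie in distinct cells of a grid of mesh [delta / (p + 1)], and the
   distance between two points is comparable to [delta] times the sup norm of
   the difference of the indices of their cells. *)
Lemma separated_sum_le (R : realType) (p : nat) (J : finType) (P : pred J)
    (x : J -> 'rV[R]_p) (delta : R) (i : J) :
  0 < delta -> (forall j j', j != j' -> delta <= enorm (x j - x j')) ->
  \sum_(j | P j && (i != j)) ((enorm (x i - x j) / delta) ^+ (2 * p))^-1
    <= shell_const R p.
Proof.
move=> d0 xsep; pose e := delta / (p%:R + 1).
have p0 : (0 : R) <= p%:R by [].
have p1 : 0 < p%:R + 1 :> R by rewrite ltr_wpDl.
have e0 : 0 < e by rewrite divr_gt0.
pose n j k := Num.floor (x j ord0 k / e).
have nP j k : (n j k)%:~R <= x j ord0 k / e < (n j k + 1)%:~R.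
  exact: floor_itv.
have dE : delta = e * (p%:R + 1) by rewrite /e divfK// gt_eqF.
clearbody e.
pose m j k := n j k - n i k.
have mI j j' : m j =1 m j' -> j = j'.
  move=> mm; apply/eqP; apply/negPn/negP => jj.
  have : enorm (x j - x j') ^+ 2 <= p%:R * e ^+ 2.
    apply: enorm_le_coord; first exact: ltW.
    move=> k; rewrite !mxE.
    have nn : n j k = n j' k by apply: (@addIr _ (- n i k)); exact: mm.
    have /andP[a b] := nP j k; have /andP[] := nP j' k; rewrite -nn => c f.
    rewrite intrD in b f.
    rewrite -[x j _ _](divfK (lt0r_neq0 e0)) -[x j' _ _](divfK (lt0r_neq0 e0)).
    rewrite -mulrBl normrM (gtr0_norm e0) ler_piMl ?(ltW e0)//.
    by rewrite ler_norml; apply/andP; split; lra.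
  apply/negP; rewrite -ltNge.
  have dj := xsep _ _ jj.
  apply: (@lt_le_trans _ _ (delta ^+ 2)); last first.
    by rewrite lerXn2r ?nnegrE ?enorm_ge0 ?(ltW d0).
  rewrite dE [ltRHS]exprMn [ltLHS]mulrC ltr_pM2l ?exprn_gt0//; nra.
apply: (@le_trans _ _ (\sum_(j | P j && (i != j))
   (p%:R + 3) ^+ (2 * p) * \prod_(k < p) (1 + `|m j k|%N%:R)^-1 ^+ 2)); last first.
  by rewrite -mulr_sumr ler_pM2l ?exprn_gt0 ?ltr_wpDl// lattice_sum_le.
apply: ler_sum => j /andP[_ ij].
have dij := xsep _ _ ij.
set t := enorm _ / delta.
have t1 : 1 <= t by rewrite ler_pdivlMr ?mul1r.
have t0 : 0 < t by rewrite (lt_le_trans ltr01).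
have c0 : (0 : R) < p%:R + 3 by rewrite ltr_wpDl.
have ct0 : 0 < (p%:R + 3) * t by exact: mulr_gt0.
rewrite -[leLHS](mulVKf (_ : (p%:R + 3) ^+ (2 * p) != 0)) ?expf_neq0 ?gt_eqF//.
rewrite ler_pM2l ?exprn_gt0// -invfM -exprMn exprM.
have -> : ((((p%:R + 3) * t) ^+ 2) ^+ p)^-1 =
   \prod_(k < p) ((((p%:R + 3) * t) ^+ 2))^-1.
  by rewrite prodr_const card_ord exprVn.
apply: ler_prod => k _; rewrite invr_ge0 sqr_ge0/= exprVn.
have q0 : (0 : R) < 1 + `|m j k|%N%:R by rewrite ltr_pwDl.
rewrite lef_pV2 ?posrE ?exprn_gt0//.
rewrite lerXn2r ?nnegrE ?(ltW q0) ?(ltW ct0)//.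
have -> : `|m j k|%N%:R = `|(m j k)%:~R| :> R.
  by rewrite natr_absz intr_norm.
have /andP[a b] := nP j k; have /andP[c f] := nP i k.
rewrite intrD in b f.
have H : `|x i ord0 k / e - x j ord0 k / e| <= t * (p%:R + 1).
  rewrite -mulrBl normrM (@gtr0_norm _ e^-1) ?invr_gt0// ler_pdivrMr//.
  rewrite -mulrA -(mulrC e) -dE divfK ?gt_eqF//.
  by have := coord_le_enorm (x i - x j) k; rewrite !mxE.
have : `|(m j k)%:~R| <= `|x i ord0 k / e - x j ord0 k / e| + 1.
  rewrite /m intrB; rewrite ler_norml.
  have [h|h] := leP 0 (x i ord0 k / e - x j ord0 k / e).
    by rewrite ger0_norm//; apply/andP; split; lra.
  by rewrite ltr0_norm//; apply/andP; split; lra.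
nra.
Qed.

Definition packable (R : realType) (p : nat) (A : set 'rV[R]_p) (delta : R)
    (T : finType) : Prop :=
  exists x : T -> 'rV[R]_p, (forall i, A (x i)) /\
    forall i j, i != j -> delta < enorm (x i - x j).

Definition packing_number (R : realType) (p : nat) (A : set 'rV[R]_p)
    (delta : R) : nat :=
  xget 0%N [set n | packable A delta 'I_n /\
                    forall m, packable A delta 'I_m -> (m <= n)%N].

Section Packing.
Variables (R : realType) (p : nat) (A : set 'rV[R]_p).
Implicit Types (delta : R) (S T : finType).

Lemma packable_inj delta S T (f : S -> T) :
  injective f -> packable A delta T -> packable A delta S.
Proof.
move=> fI [x [Ax xsep]]; exists (x \o f); split => [i|i j ij] /=.
  exact: Ax.
by apply: xsep; rewrite (inj_eq fI).
Qed.

Lemma packable_card delta S T :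
  (#|S| <= #|T|)%N -> packable A delta T -> packable A delta S.
Proof.
move=> ST; apply: (@packable_inj _ _ _
  (fun s => enum_val (widen_ord ST (enum_rank s)))).
move=> s s' /enum_val_inj /(congr1 val)/= /val_inj; exact: enum_rank_inj.
Qed.

Lemma packable_le delta delta' T :
  delta <= delta' -> packable A delta' T -> packable A delta T.
Proof.
move=> dd [x [Ax xsep]]; exists x; split => // i j ij.
exact: le_lt_trans (xsep _ _ ij).
Qed.

Lemma separation_gtP delta N (x : 'I_N -> 'rV[R]_p) :
  (delta%:E < separation x)%E <->
  forall i j, i != j -> delta < enorm (x i - x j).
Proof.
split=> [/bigmin_gtP[_ H] i j ij|H].
  have /bigmin_gtP[_ /(_ j ij)] := H i isT.
  by rewrite lte_fin.
apply/bigmin_gtP; split; first exact: ltry.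
move=> i _; apply/bigmin_gtP; split; first exact: ltry.
by move=> j ij; rewrite lte_fin; exact: H.
Qed.

Lemma best_packing_gtP delta N : 0 <= delta ->
  (delta%:E < best_packing A N)%E <-> packable A delta 'I_N.
Proof.
move=> d0; split=> [/ereal_sup_gt[_ [x [_ Ax] <-]] /separation_gtP xsep|].
  by exists x.
move=> [x [Ax xsep]]; apply/ereal_sup_gtP; exists (separation x); last first.
  exact/separation_gtP.
exists x => //; split=> // i j xij; apply/eqP; apply: contraT => /xsep.
by rewrite xij subrr enorm0 ltNge d0.
Qed.

Hypothesis cA : compact A.

Lemma compact_enorm_bounded :
  exists2 D : R, 0 < D & forall x y, A x -> A y -> enorm (x - y) <= D.
Proof.
have [B [_ AB]] := compact_bounded cA.
pose C := `|B| + 1; pose D := (p%:R + 1) * (C + C).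
have C0 : 0 < C by rewrite ltr_wpDl.
have p0 : (0 : R) <= p%:R by [].
have pp : (0 : R) < p%:R + 1 by rewrite ltr_wpDl.
exists D; first by rewrite /D mulr_gt0// addr_gt0.
move=> x y Ax Ay.
have BC : B < C by rewrite /C (le_lt_trans (ler_norm B))// ltrDl.
have xyC : `|x - y| <= C + C.
  by apply: (le_trans (ler_normB _ _)); apply: lerD; exact: (AB C BC).
rewrite -(@ler_pXn2r _ 2) ?nnegrE ?enorm_ge0//; last first.
  by rewrite mulr_ge0 ?addr_ge0// ltW.
have := @enorm_le_coord _ _ (x - y) (C + C) (ltW (addr_gt0 C0 C0))
  (fun k => le_trans (coord_le_norm _ k) xyC).
move=> /le_trans; apply; rewrite /D exprMn ler_wpM2r ?sqr_ge0//; nra.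
Qed.

Lemma packable_bounded delta : 0 < delta ->
  exists n, forall T, packable A delta T -> (#|T| <= n)%N.
Proof.
move=> d0; have [D D0 AD] := compact_enorm_bounded.
pose K := shell_const R p * (D / delta) ^+ (2 * p).
exists (Num.truncn K).+1 => T [x [Ax xsep]].
have [T0|/card_gt0P[i _]] := posnP #|T|; first by rewrite T0.
have := @separated_sum_le R p T predT x delta i d0 (fun j j' jj => ltW (xsep j j' jj)).
set c := ((D / delta) ^+ (2 * p))^-1.
have Dd0 : 0 < D / delta by rewrite divr_gt0.
have cE : K * c = shell_const R p.
  by rewrite /K /c mulfK// expf_neq0// gt_eqF.
have c0 : 0 < c by rewrite invr_gt0 exprn_gt0.
have H : #|T|.-1%:R * c <=
    \sum_(j | predT j && (i != j)) ((enorm (x i - x j) / delta) ^+ (2 * p))^-1.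
  have -> : #|T|.-1%:R * c = \sum_(j | predT j && (i != j)) c.
    rewrite sumr_const mulr_natl; congr (_ *+ _).
    by rewrite -(cardC1 i); apply: eq_card => j; rewrite !inE eq_sym.
  apply: ler_sum => j /andP[_ ij]; rewrite lef_pV2 ?posrE ?exprn_gt0//; last first.
    by rewrite divr_gt0// (lt_trans d0 (xsep _ _ ij)).
  rewrite lerXn2r ?nnegrE ?divr_ge0 ?enorm_ge0 ?(ltW d0) ?(ltW D0)//.
  by rewrite ler_pM2r ?invr_gt0// AD.
move=> /(le_trans H); rewrite -cE ler_pM2r// => TK.
have := truncnS_gt K; rewrite -natr1 => KT.
have := le_lt_trans TK KT; rewrite natr1 ltr_nat.
by case: #|T|.
Qed.

Lemma packing_numberP delta T : 0 < delta ->
  packable A delta T <-> (#|T| <= packing_number A delta)%N.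
Proof.
move=> d0; have [n nP] := packable_bounded d0.
have [m [mP mmax]] : exists m, packable A delta 'I_m /\
    forall k, packable A delta 'I_k -> (k <= m)%N.
  have P0 : packable A delta 'I_0 by exists (fun=> 0); split=> [] [].
  have ex : exists k, `[< packable A delta 'I_k >] by exists 0%N; apply/asboolP.
  have ub k : `[< packable A delta 'I_k >] -> (k <= n)%N.
    by move=> /asboolP/nP; rewrite card_ord.
  case: (ex_maxnP ex ub) => m /asboolP mP mmax; exists m; split=> // k kP.
  by apply: mmax; apply/asboolP.
rewrite /packing_number; case: xgetP => [k _ [kP kmax]|/(_ m)]; last by case.
split=> H.
  by apply: kmax; apply: packable_card H; rewrite card_ord.
by apply: packable_card kP; rewrite card_ord.
Qed.

Lemma le_packing_number delta delta' : 0 < delta -> delta <= delta' ->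
  (packing_number A delta' <= packing_number A delta)%N.
Proof.
move=> d0 dd; have d0' := lt_le_trans d0 dd.
rewrite -[leqLHS]card_ord; apply/(packing_numberP _ d0).
by apply: (packable_le dd); apply/(packing_numberP _ d0'); rewrite card_ord.
Qed.

Lemma packing_number_gt0 delta : 0 < delta -> A !=set0 ->
  (0 < packing_number A delta)%N.
Proof.
move=> d0 [a Aa]; rewrite -[X in (X <= _)%N](card_ord 1).
apply/(packing_numberP _ d0); exists (fun=> a); split=> // i j.
by rewrite !ord1 eqxx.
Qed.

End Packing.

Section SelfSimilar.
Variables (R : realType) (p M : nat) (psi : 'I_M -> 'rV[R]_p -> 'rV[R]_p).
Variables (rs : 'I_M -> R) (A : set 'rV[R]_p).
Hypothesis hA : self_similar_fractal psi rs A.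

Lemma self_similar_gap : exists2 h : R, 0 < h &
  forall m n x y, m != n -> A x -> A y -> h <= enorm (psi m x - psi n y).
Proof.
have [_ psiS [_ cA] _ disj] := hA.
have cpsi m : compact (psi m @` A).
  apply: continuous_compact => //; apply: continuous_subspaceT.
  exact: similitude_continuous (psiS m).
have H (q : 'I_M * 'I_M) : exists h : R, 0 < h /\ (q.1 != q.2 ->
    forall x y, A x -> A y -> h <= enorm (psi q.1 x - psi q.2 y)).
  case: q => m n /=; have [->|mn] := eqVneq m n; first by exists 1.
  have [|h h0 hP] := compact_disjoint_gap (cpsi m) (cpsi n).
    apply: contrapT => /eqP/set0P K0.
    by move: mn; rewrite (disj m n I I K0) eqxx.
  by exists h; split=> // _ x y Ax Ay; apply: hP; [exists x|exists y].
have [f fP] := choice H.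
exists (\big[Num.min/1]_q f q).
  by apply: lt_bigmin => // q _; have [] := fP q.
move=> m n x y mn Ax Ay; apply: (le_trans (bigmin_le _ (m, n) _)).
by have [_] := fP (m, n); apply.
Qed.

Lemma self_similar_packing_recurrence : exists2 h : R, 0 < h &
  forall delta, 0 < delta < h ->
    packing_number A delta = (\sum_m packing_number A (delta / rs m))%N.
Proof.
have [M2 psiS [A0 cA] AE disj] := hA.
have [h h0 gap] := self_similar_gap.
have rs0 m : 0 < rs m by have [/andP[]] := psiS m.
exists h => // delta /andP[d0 dh].
have dr0 m : 0 < delta / rs m by rewrite divr_gt0.
apply/eqP; rewrite eqn_leq; apply/andP; split; last first.
  pose T := {m : 'I_M & 'I_(packing_number A (delta / rs m))}.
  have <- : #|{: T}| = (\sum_m packing_number A (delta / rs m))%N.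
    rewrite card_tagged sumnE big_map big_enum/=.
    by apply: eq_bigr => m _; rewrite card_ord.
  apply/(packing_numberP cA _ d0).
  have H m : exists x : 'I_(packing_number A (delta / rs m)) -> 'rV[R]_p,
      (forall i, A (x i)) /\
      forall i j, i != j -> delta / rs m < enorm (x i - x j).
    by apply/(packing_numberP cA _ (dr0 m)); rewrite card_ord.
  pose x m := sval (cid (H m)).
  have xP m : (forall i, A (x m i)) /\
      forall i j, i != j -> delta / rs m < enorm (x m i - x m j).
    exact: svalP (cid (H m)).
  exists (fun t : T => psi (tag t) (x (tag t) (tagged t))); split.
    move=> [m i]/=; rewrite AE; exists m => //; exists (x m i) => //.
    by have [] := xP m.
  move=> [m i] [n j] ij /=.
  have [mn|mn] := eqVneq m n; last first.
    apply: (lt_le_trans dh); apply: gap => //; last by have [] := xP n.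
    by have [] := xP m.
  subst n; rewrite (enorm_similitude _ _ (psiS m)) mulrC -ltr_pdivrMr//.
  have [_ ] := xP m; apply; apply: contraNneq ij => ->; exact: eqxx.
have [x [Ax xsep]] : packable A delta 'I_(packing_number A delta).
  by apply/(packing_numberP cA _ d0); rewrite card_ord.
have H i : exists q : 'I_M * 'rV[R]_p, A q.2 /\ psi q.1 q.2 = x i.
  by have := Ax i; rewrite {1}AE => -[m _ [y Ay yx]]; exists (m, y).
have [f fP] := choice H.
rewrite -[leqLHS]card_ord -sum1_card (partition_big (fun i => (f i).1) predT)//=.
apply: leq_sum => m _.
rewrite sum1_card -card_sig; apply/(packing_numberP cA _ (dr0 m)).
exists (fun t => (f (val t)).2); split; first by move=> t; have [] := fP (val t).
move=> s t st.
have := xsep (val s) (val t) st.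
have [_ <-] := fP (val s); have [_ <-] := fP (val t).
have fm (u : {i | (f i).1 == m}) : (f (val u)).1 = m by apply/eqP; exact: (valP u).
by rewrite !fm (enorm_similitude _ _ (psiS m)) mulrC -ltr_pdivrMr.
Qed.

End SelfSimilar.

(* Conserved quantity of the renewal equation [u_n = \sum_m w_m u_(n - i_m)]. *)
Lemma renewal_invariant (R : pzRingType) (M I : nat) (w : 'I_M -> R)
    (i : 'I_M -> nat) (u : nat -> R) :
  \sum_m w m = 1 -> (forall m, (i m <= I)%N) ->
  (forall k, u (k + I)%N = \sum_m w m * u (k + I - i m)%N) ->
  forall k, \sum_m w m * \sum_(j < i m) u (k + I - i m + j)%N =
            \sum_m w m * \sum_(j < i m) u (I - i m + j)%N.
Proof.
move=> w1 iI uE; elim=> [|k <-].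
  by apply: eq_bigr => m _; rewrite add0n.
have shift n (v : nat -> R) : \sum_(j < n) v j.+1 = \sum_(j < n) v j + v n - v 0%N.
  transitivity (\sum_(j < n.+1) v j - v 0%N); last by rewrite big_ord_recr.
  by rewrite big_ord_recl/= addrAC subrr add0r.
apply/eqP; rewrite -subr_eq0 -sumrB.
under eq_bigr => m _.
  rewrite -mulrBr.
  have -> : \sum_(j < i m) u (k.+1 + I - i m + j)%N =
      \sum_(j < i m) u (k + I - i m + j.+1)%N.
    by apply: eq_bigr => j _; rewrite addSn subSn ?addSnnS// (leq_trans (iI m)) ?leq_addl.
  rewrite (shift _ (fun j => u (k + I - i m + j)%N)) addrAC.
  rewrite [X in X - _]addrAC subrr add0r.
  rewrite subnK ?(leq_trans (iI m)) ?leq_addl// addn0 addrC mulrDr mulrN.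
  over.
by rewrite big_split/= sumrN -uE -mulr_suml w1 mul1r addNr.
Qed.

Lemma cvg_powR (R : realType) (d l : R) (y : nat -> R) :
  0 < d -> (forall k, 0 <= y k) -> y @ \oo --> l ->
  (fun k => y k `^ d) @ \oo --> l `^ d.
Proof.
move=> d0 y0 yl.
have l0 : 0 <= l.
  by rewrite -(cvg_lim _ yl)//; apply: limr_ge; [exact: cvgP yl|exact: nearW].
move: l0; rewrite le_eqVlt => /predU1P[l0|l0]; last first.
  apply: (@continuous_cvg _ _ _ _ _ y (fun t => t `^ d)) => //.
  apply/differentiable_continuous/derivable1_diffP/derivable_powR.
  by rewrite in_itv/= l0.
rewrite -l0 powR0 ?gt_eqF//; apply/cvgrPdist_lt => e e0.
have ee : 0 < e `^ d^-1 by exact: powR_gt0.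
near=> k; rewrite sub0r normrN ger0_norm ?powR_ge0//.
have -> : e = (e `^ d^-1) `^ d by rewrite -powRrM mulVf ?gt_eqF// powRr1// ltW.
apply: gt0_ltr_powR; rewrite ?nnegrE ?powR_ge0//.
have : `|l - y k| < e `^ d^-1.
  by near: k; exact: cvgr_dist_lt.
by rewrite -l0 sub0r normrN ger0_norm.
Unshelve. all: by end_near.
Qed.

Lemma renewal_limit (R : realType) (M I : nat) (w : 'I_M -> R)
    (i : 'I_M -> nat) (u : nat -> R) (C : R) :
  \sum_m w m = 1 -> (forall m, (i m <= I)%N) ->
  (forall k, u (k + I)%N = \sum_m w m * u (k + I - i m)%N) ->
  u @ \oo --> C ->
  \sum_m w m * \sum_(j < i m) u (I - i m + j)%N = C * \sum_m w m * (i m)%:R.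
Proof.
move=> w1 iI uE uC.
have QE := renewal_invariant w1 iI uE.
set Q := LHS.
pose q k := \sum_m w m * \sum_(j < i m) u (k + I - i m + j)%N.
have qQ : q @ \oo --> Q by rewrite (_ : q = cst Q); [exact: cvg_cst|exact/funext].
have qC : q @ \oo --> \sum_m w m * \sum_(j < i m) C.
  apply: cvg_big; first exact: add_continuous.
  move=> m _; apply: cvgMl_tmp; apply: cvg_big; first exact: add_continuous.
  move=> j _; apply: (@cvg_comp _ _ _ (fun k => k + I - i m + j)%N u) uC.
  under eq_fun do rewrite -addnBA// -addnA.
  exact: cvg_addnr.
have -> : Q = \sum_m w m * \sum_(j < i m) C by exact: cvg_unique qQ qC.
rewrite mulr_sumr; apply: eq_bigr => m _.
by rewrite sumr_const card_ord -(mulr_natr C) mulrCA.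
Qed.

Section Fractal.
Variables (R : realType) (p M : nat) (psi : 'I_M -> 'rV[R]_p -> 'rV[R]_p).
Variables (rs : 'I_M -> R) (A : set 'rV[R]_p) (d : R).
Hypothesis hA : self_similar_fractal psi rs A.
Hypothesis hd : similarity_dimension rs d.

Lemma ratio_gt0 m : 0 < rs m.
Proof. by have [_ psiS _ _ _] := hA; have [/andP[]] := psiS m. Qed.

Lemma similarity_dimension_gt0 : 0 < d.
Proof.
have [M2 psiS _ _ _] := hA; rewrite ltNge; apply/negP => d0.
have : \sum_(m < M) (1 : R) <= \sum_(m < M) rs m `^ d.
  apply: ler_sum => m _; have [/andP[r0 r1] _] := psiS m.
  by rewrite -(powRr0 (rs m)) ger_powR// r0 ltW.
by rewrite hd sumr_const card_ord -[1 in X in _ <= X]/(1%:R) ler_nat leqNgt M2.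
Qed.

Variables (r : R) (i : 'I_M -> nat).
Hypotheses (hr : 0 < r < 1) (hi : forall k, (0 < i k)%N).
Hypothesis hrs : forall k, rs k = r ^+ i k.

Let I := \max_m i m.
Let iI m : (i m <= I)%N. Proof. exact: leq_bigmax. Qed.
Let r0 : 0 < r. Proof. by case/andP: hr. Qed.
Let d0 := similarity_dimension_gt0.
Let cA : compact A. Proof. by have [_ _ []] := hA. Qed.

Variable h : R.
Hypothesis h0 : 0 < h.
Hypothesis hP : forall delta, 0 < delta < h ->
  packing_number A delta = (\sum_m packing_number A (delta / rs m))%N.

Definition packing_seq (delta : R) (k : nat) : R :=
  (packing_number A (r ^+ k * delta))%:R * (r ^+ k * delta) `^ d.

Lemma scaled_packing_recurrence (delta : R) :
  0 < delta < h -> forall k,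
  packing_number A (r ^+ (k + I) * delta) =
  (\sum_m packing_number A (r ^+ (k + I - i m) * delta))%N.
Proof.
move=> /andP[delta0 deltah] k.
have r1 : r <= 1 by rewrite ltW//; case/andP: hr.
rewrite hP; last first.
  rewrite mulr_gt0 ?exprn_gt0//=; apply: le_lt_trans deltah.
  by rewrite ler_piMl ?(ltW delta0)// exprn_ile1 ?(ltW r0).
apply: eq_bigr => m _; congr packing_number.
rewrite hrs mulrAC; congr (_ * _).
have kim : (i m <= k + I)%N by rewrite (leq_trans (iI m)) ?leq_addl.
by rewrite -{1}(subnK kim) exprD mulfK// expf_neq0// gt_eqF.
Qed.

Lemma packing_seq_recurrence (delta : R) :
  0 < delta < h -> forall k,
  packing_seq delta (k + I) =
  \sum_m rs m `^ d * packing_seq delta (k + I - i m).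
Proof.
move=> hdelta k; have /andP[delta0 _] := hdelta.
rewrite /packing_seq (scaled_packing_recurrence hdelta) natr_sum mulr_suml.
apply: eq_bigr => m _; rewrite mulrCA; congr (_ * _).
have kim : (i m <= k + I)%N by rewrite (leq_trans (iI m)) ?leq_addl.
rewrite -powRM ?(ltW (ratio_gt0 m))//; last first.
  by rewrite mulr_ge0 ?exprn_ge0 ?ltW.
by rewrite hrs mulrA -exprD subnKC.
Qed.

Lemma packing_seq_ge0 delta k : 0 <= packing_seq delta k.
Proof. by rewrite mulr_ge0// powR_ge0. Qed.

Lemma packing_number_geometric_ge (delta : R) :
  0 < delta < h -> forall k n, (n * I <= k)%N ->
  (n <= packing_number A (r ^+ k * delta))%N.
Proof.
move=> hdelta; have /andP[delta0 _] := hdelta.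
have [M2 _ [A0 _] _ _] := hA.
have rk0 k : 0 < r ^+ k * delta by rewrite mulr_gt0 ?exprn_gt0.
have mono k k' : (k <= k')%N ->
    (packing_number A (r ^+ k * delta) <= packing_number A (r ^+ k' * delta))%N.
  move=> kk; apply: le_packing_number => //; rewrite ler_pM2r//.
  by rewrite ler_wiXn2l ?(ltW r0)// ltW//; case/andP: hr.
move=> k n; elim: n k => [//|n IH] k; rewrite mulSn => nk.
have Ik : (I <= k)%N by apply: leq_trans nk; exact: leq_addr.
rewrite -(subnK Ik) (scaled_packing_recurrence hdelta).
have nk' : (n * I <= k - I)%N by rewrite leq_subRL.
have := IH _ nk'; set q := packing_number _ _ => nq.
have q0 : (0 < q)%N by exact: packing_number_gt0.
apply: (@leq_trans (\sum_(m < M) q)%N); last first.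
  apply: leq_sum => m _; apply: mono; rewrite subnK//.
  by rewrite leq_sub2l.
rewrite sum_nat_const card_ord.
apply: (@leq_trans (2 * q)%N); last by rewrite leq_mul2r M2 orbT.
by rewrite mul2n -addnn -add1n leq_add.
Qed.

Lemma packing_seq_bounded (delta : R) :
  0 < delta < h -> exists B : R, forall k, packing_seq delta (k + I) <= B.
Proof.
move=> hdelta; have [M2 _ _ _ _] := hA; have /andP[delta0 _] := hdelta.
pose m0 : 'I_M := Ordinal (ltnW M2).
have [Q QE] : exists Q, forall k, \sum_m rs m `^ d *
    \sum_(j < i m) packing_seq delta (k + I - i m + j) = Q.
  by eexists; exact: renewal_invariant hd iI (packing_seq_recurrence hdelta).
have w0 m : 0 < rs m `^ d by rewrite powR_gt0// ratio_gt0.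
exists (Q / rs m0 `^ d) => k; rewrite ler_pdivlMr// mulrC -(QE k.+1).
rewrite (bigD1 m0)//= -[leLHS]addr0; apply: lerD; last first.
  apply: sumr_ge0 => m _; rewrite mulr_ge0 ?(ltW (w0 _))//.
  by rewrite sumr_ge0// => j _; exact: packing_seq_ge0.
rewrite ler_pM2l//.
have jP : ((i m0).-1 < i m0)%N by rewrite prednK.
rewrite (bigD1 (Ordinal jP))//= -[leLHS]addr0; apply: lerD; last first.
  by rewrite sumr_ge0// => j _; exact: packing_seq_ge0.
have -> : (k.+1 + I - i m0 + (i m0).-1 = k + I)%N; last by [].
case: (i m0) (hi m0) (iI m0) => // a _ aI.
by rewrite addSn subSS subnK// (leq_trans (ltnW aI))// leq_addl.
Qed.

Lemma packing_seq_no_common_limit (C : R) :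
  ~ forall delta, 0 < delta < h -> packing_seq delta @ \oo --> C.
Proof.
move=> HC; have [M2 _ _ _ _] := hA.
pose m0 : 'I_M := Ordinal (ltnW M2).
have w0 m : 0 < rs m `^ d by rewrite powR_gt0// ratio_gt0.
pose e m (j : 'I_(i m)) := (I - i m + j)%N.
have eI m (j : 'I_(i m)) : (e m j < I)%N.
  by rewrite /e -ltn_subRL subKn.
pose S delta := \sum_m rs m `^ d * \sum_(j < i m)
  (packing_number A (r ^+ e m j * delta))%:R * (r ^+ e m j) `^ d.
have SE delta : 0 < delta < h ->
    S delta * delta `^ d = C * \sum_m rs m `^ d * (i m)%:R.
  move=> hdelta; have /andP[delta0 _] := hdelta.
  rewrite -(renewal_limit hd iI (packing_seq_recurrence hdelta) (HC _ hdelta)).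
  rewrite mulr_suml; apply: eq_bigr => m _.
  rewrite -mulrA mulr_suml; congr (_ * _); apply: eq_bigr => j _.
  by rewrite -mulrA -powRM// ?exprn_ge0 ?ltW.
have S0 delta : 0 < delta -> 0 < S delta.
  move=> delta0; have [_ _ [A0 _] _ _] := hA.
  have t0 m (j : 'I_(i m)) :
    0 < (packing_number A (r ^+ e m j * delta))%:R * (r ^+ e m j) `^ d.
    rewrite mulr_gt0 ?powR_gt0 ?exprn_gt0// ltr0n packing_number_gt0//.
    by rewrite mulr_gt0 ?exprn_gt0.
  rewrite /S (bigD1 m0)//= ltr_pwDl//.
    rewrite mulr_gt0// (bigD1 (Ordinal (hi m0)))//= ltr_pwDl// sumr_ge0// => j _.
    exact: ltW.
  rewrite sumr_ge0// => m _; rewrite mulr_ge0 ?(ltW (w0 _))// sumr_ge0// => j _.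
  exact: ltW.
pose T delta := (\sum_(k < I) packing_number A (r ^+ k * delta))%N.
have [delta [hdelta Tmin]] : exists delta, 0 < delta < h /\
    forall delta', 0 < delta' < h -> (T delta <= T delta')%N.
  have ex : exists n, `[< exists2 delta, 0 < delta < h & T delta = n >].
    by exists (T (h / 2)); apply/asboolP; exists (h / 2) => //; have := h0; lra.
  case: (ex_minnP ex) => n /asboolP[delta hdelta <-] nmin.
  exists delta; split=> // delta' hdelta'; apply: nmin.
  by apply/asboolP; exists delta'.
have /andP[delta0 deltah] := hdelta.
pose delta' := (delta + h) / 2.
have dd : delta < delta' by rewrite /delta'; lra.
have hdelta' : 0 < delta' < h by rewrite /delta'; lra.
have PP (k : nat) :
    (packing_number A (r ^+ k * delta') <= packing_number A (r ^+ k * delta))%N.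
  apply: le_packing_number => //; first by rewrite mulr_gt0 ?exprn_gt0.
  by rewrite ler_pM2l ?exprn_gt0// ltW.
have PE (k : nat) : (k < I)%N ->
    packing_number A (r ^+ k * delta') = packing_number A (r ^+ k * delta).
  move=> kI.
  have [_] : (T delta' <= T delta ?= iff [forall k : 'I_I,
      packing_number A (r ^+ k * delta') == packing_number A (r ^+ k * delta)])%N.
    by apply: leqif_sum => j _; apply: leqif_eq.
  rewrite eqn_leq Tmin// andbT => /esym.
  have -> : (T delta' <= T delta)%N by apply: leq_sum => j _.
  by move=> /forallP/(_ (Ordinal kI))/eqP.
have SS : S delta' = S delta.
  apply: eq_bigr => m _; congr (_ * _); apply: eq_bigr => j _.
  by rewrite PE.
have := SE _ hdelta'; rewrite SS -(SE _ hdelta) => /(mulfI (lt0r_neq0 (S0 _ delta0))).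
apply/eqP; rewrite gt_eqF// gt0_ltr_powR ?nnegrE ?(ltW delta0)//.
by rewrite ltW// (lt_trans delta0).
Qed.

End Fractal.

Lemma packing_no_limit (R : realType) (p M : nat)
    (psi : 'I_M -> 'rV[R]_p -> 'rV[R]_p) (rs : 'I_M -> R)
    (A : set 'rV[R]_p) (d : R) (r : R) (i : 'I_M -> nat) :
  self_similar_fractal psi rs A -> similarity_dimension rs d ->
  0 < r < 1 -> (forall k, (0 < i k)%N) -> (forall k, rs k = r ^+ i k) ->
  ~ cvg ((best_packing A N * (N%:R `^ d^-1)%:E)%E @[N --> \oo]).
Proof.
move=> hA hd hr hi hrs /cvg_ex[L].
set v := (X in X @ _ --> _) => vL.
have d0 := similarity_dimension_gt0 hA hd.
have dV0 : 0 < d^-1 by rewrite invr_gt0.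
have r0 : 0 < r by case/andP: hr.
have [_ _ [A0 cA] _ _] := hA.
have [h h0 hP] := self_similar_packing_recurrence hA.
apply: (packing_seq_no_common_limit hA hd hr hi hrs h0 hP (C := fine L `^ d)).
move=> delta hdelta; have /andP[delta0 _] := hdelta.
pose n k := packing_number A (r ^+ k * delta).
have rk0 k : 0 < r ^+ k * delta by rewrite mulr_gt0 ?exprn_gt0.
have n0 k : (0 < n k)%N by exact: packing_number_gt0.
have nR0 k : 0 < (n k)%:R :> R by rewrite ltr0n.
pose y k : R := r ^+ k * delta * (n k)%:R `^ d^-1.
have y0 k : 0 <= y k by rewrite mulr_ge0 ?powR_ge0// ltW.
have yE k : packing_seq A d r delta k = y k `^ d.
  rewrite /y powRM ?powR_ge0 ?(ltW (rk0 _))// -powRrM mulVf ?gt_eqF//.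
  by rewrite powRr1 1?mulrC.
have up k : ((y k)%:E <= v (n k))%E.
  rewrite /v EFinM; apply: lee_wpmul2r; first by rewrite lee_fin powR_ge0.
  apply/ltW/best_packing_gtP; first exact: ltW.
  by apply/(packing_numberP cA _ (rk0 k)); rewrite card_ord.
pose c N : R := (N%:R / N.+1%:R) `^ d^-1.
have c0 N : 0 <= c N by exact: powR_ge0.
have low k : (v (n k).+1 * (c (n k))%:E <= (y k)%:E)%E.
  have -> : y k = r ^+ k * delta * (n k).+1%:R `^ d^-1 * c (n k).
    by rewrite -mulrA -powRM ?divr_ge0// mulrC -[RHS]mulrC mulrCA divff ?mulr1//
      pnatr_eq0.
  rewrite EFinM; apply: lee_wpmul2r; first by rewrite lee_fin.
  rewrite /v EFinM; apply: lee_wpmul2r; first by rewrite lee_fin powR_ge0.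
  rewrite leNgt; apply/negP => /(best_packing_gtP _ _ (ltW (rk0 k))).
  by move=> /(packing_numberP cA _ (rk0 k)); rewrite card_ord ltnn.
have c1 : c @ \oo --> (1 : R).
  have := @cvg_powR R d^-1 1 (fun N => N%:R / N.+1%:R) dV0.
  rewrite powR1; apply; first by move=> k; rewrite divr_ge0.
  rewrite -[X in _ --> X]subr0 (_ : (fun k => _) = (fun k => 1 - harmonic k)).
    by apply: cvgB; [exact: cvg_cst|exact: cvg_harmonic].
  apply/funext => k; rewrite /harmonic/=.
  rewrite -[X in X - _](@divff _ (k.+1%:R : R)) ?pnatr_eq0//.
  by rewrite -[X in _ - X]mul1r -mulrBl -natr1 addrK.
have nny : n @ \oo --> \oo.
  apply/cvgnyPge => N; exists (N * \max_m i m)%N => // k /= Nk.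
  exact: (packing_number_geometric_ge hA hr hrs hP hdelta).
have vn : v \o n @ \oo --> L by exact: cvg_comp vL.
have vn1 : (fun k => v (n k).+1) @ \oo --> L.
  have vS : (fun N => v N.+1) @ \oo --> L by rewrite (cvg_shiftS v).
  exact: (cvg_comp _ _ nny vS).
have cn : (fun k => (c (n k))%:E) @ \oo --> 1%:E.
  by apply: cvg_EFin; [exact: nearW|exact: (cvg_comp _ _ nny c1)].
have [B HB] := packing_seq_bounded hA hd hr hi hrs hP hdelta.
have yB k : y (k + \max_m i m)%N <= B `^ d^-1.
  have yy : y (k + \max_m i m)%N = packing_seq A d r delta (k + \max_m i m)%N `^ d^-1.
    by rewrite yE -powRrM mulfV ?gt_eqF// powRr1.
  rewrite yy; apply: ge0_ler_powR; rewrite ?nnegrE ?(ltW dV0)//.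
  - exact: packing_seq_ge0.
  - exact: le_trans (packing_seq_ge0 _ _ _ _ _) (HB k).
have vcn : (fun k => v (n k).+1 * (c (n k))%:E)%E @ \oo --> L.
  rewrite -[X in _ --> X]mule1; apply: cvgeM => //.
  by rewrite mule_defE eqe oner_eq0 andbF.
have L0 : (0 <= L)%E.
  by apply: cvge_to_ge vn _; apply: nearW => k /=;
    apply: le_trans (up k); rewrite lee_fin.
have LB : (L <= (B `^ d^-1)%:E)%E.
  apply: cvge_to_le vcn _; exists (\max_m i m)%N => // k /= Ik.
  by apply: (le_trans (low k)); rewrite lee_fin -(subnK Ik).
have /fineK LE : L \is a fin_num.
  by rewrite ge0_fin_numE//; apply: le_lt_trans LB _; exact: ltry.
have yL : (fun k => (y k)%:E) @ \oo --> (fine L)%:E.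
  rewrite LE; apply: squeeze_cvge vcn vn.
  by apply: nearW => k; rewrite low up.
rewrite (_ : packing_seq _ _ _ _ = fun k => y k `^ d); last exact/funext.
by apply: cvg_powR => //; exact: fine_cvg yL.
Qed.

Section Oscillation.
Variable R : realType.
Implicit Types (u : (\bar R)^nat) (c l : \bar R).

Lemma cvge_frequently_le u l c : u @ \oo --> l ->
  (forall n, exists2 N, (n <= N)%N & (u N <= c)%E) -> (l <= c)%E.
Proof.
move=> ul H; rewrite leNgt; apply/negP => /open_ereal_gt' /ul[n _ Hn].
by have [N nN] := H n; rewrite leNgt (Hn N nN).
Qed.

Lemma cvge_frequently_ge u l c : u @ \oo --> l ->
  (forall n, exists2 N, (n <= N)%N & (c <= u N)%E) -> (c <= l)%E.
Proof.
move=> ul H; rewrite leNgt; apply/negP => /open_ereal_lt' /ul[n _ Hn].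
by have [N nN] := H n; rewrite leNgt (Hn N nN).
Qed.

Lemma ge0_lte_between l c : (0 <= l)%E -> (l < c)%E ->
  exists a b : R, [/\ 0 < a, a < b, (l < a%:E)%E & (b%:E < c)%E].
Proof.
case: l => [l| |//]; last by move=> _; rewrite ltNge leey.
rewrite lee_fin => l0.
case: c => [c||//]; last first.
  by move=> _; exists (l + 1), (l + 2); rewrite lte_fin ltry; split=> //; lra.
rewrite lte_fin => lc; exists ((2 * l + c) / 3), ((l + 2 * c) / 3).
by rewrite !lte_fin; split; lra.
Qed.

Lemma not_cvg_oscillates u : (forall n, 0 <= u n)%E -> ~ cvgn u ->
  exists a b : R, [/\ 0 < a, a < b,
    forall n, exists2 N, (n <= N)%N & (u N < a%:E)%E &
    forall n, exists2 N, (n <= N)%N & (b%:E < u N)%E].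
Proof.
move=> u0 ucvg; set l := ereal_sup (range (einfs u)).
set m := ereal_inf (range (esups u)).
have lm : (l < m)%E.
  rewrite ltNge; apply/negP => ml; apply: ucvg; apply/cvg_ex; exists l.
  have lm : l = m.
    apply/eqP; rewrite eq_le ml andbT; apply: ge_ereal_sup => _ [n _ <-].
    apply: le_ereal_inf_tmp => _ [k _ <-].
    apply: (@le_trans _ _ (einfs u (maxn n k))).
      by apply: nondecreasing_einfs; exact: leq_maxl.
    apply: (le_trans (einfs_le_esups _ _)).
    by apply: nonincreasing_esups; exact: leq_maxr.
  apply: (@squeeze_cvge _ _ _ _ (einfs u) _ (esups u)).
  - apply: nearW => n; apply/andP; split.
      by apply: ereal_inf_lbound; exists n => /=.
    by apply: ereal_sup_ubound; exists n => /=.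
  - exact: cvg_einfs_sup.
  - by rewrite lm; exact: cvg_esups_inf.
have l0 : (0 <= l)%E.
  apply: (@le_trans _ _ (einfs u 0)); last by apply: ereal_sup_ubound; exists 0%N.
  by apply: le_ereal_inf_tmp => _ [n _ <-].
have [a [b [a0 ab la bm]]] := ge0_lte_between l0 lm.
exists a, b; split=> // n.
- have : (einfs u n < a%:E)%E.
    by apply: le_lt_trans la; apply: ereal_sup_ubound; exists n.
  by move=> /ereal_inf_ltP[_ [N nN <-]]; exists N.
- have : (b%:E < esups u n)%E.
    by apply: (lt_le_trans bm); apply: ereal_inf_lbound; exists n.
  by move=> /ereal_sup_gtP[_ [N nN <-]]; exists N.
Qed.

End Oscillation.

Section Energy.
Variables (R : realType) (p : nat) (A : set 'rV[R]_p).

Lemma min_riesz_energy_le (s delta : R) (N : nat) :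
  (2 * p)%:R <= s -> 0 < delta -> packable A delta 'I_N ->
  (min_riesz_energy s A N <=
   (N%:R * (shell_const R p * delta `^ (- s)))%:E)%E.
Proof.
move=> ps d0 [x [Ax xsep]].
apply: (@le_trans _ _ (riesz_energy s x)%:E).
  apply: ereal_inf_lbound; exists x => //; split=> // i j xij.
  apply/eqP; apply: contraT => /xsep.
  by rewrite xij subrr enorm0 ltNge ltW.
rewrite lee_fin.
have -> : N%:R * (shell_const R p * delta `^ (- s)) =
    \sum_(i < N) shell_const R p * delta `^ (- s).
  by rewrite sumr_const card_ord mulr_natl.
apply: ler_sum => i _.
apply: le_trans (ler_wpM2r (powR_ge0 _ _) (@separated_sum_le R p _ predT x delta i d0
  (fun j j' jj => ltW (xsep j j' jj)))).
rewrite mulr_suml; apply: ler_sum => j ij; rewrite /= in ij.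
have xd := xsep _ _ ij.
set t := enorm _ / delta.
have t1 : 1 <= t by rewrite ler_pdivlMr// mul1r ltW.
have -> : enorm (x i - x j) = t * delta by rewrite divfK// gt_eqF.
have t0 : 0 <= t by exact: le_trans t1.
clearbody t; rewrite powRM ?(ltW d0)// ler_wpM2r ?powR_ge0//.
rewrite -powR_invn//.
by rewrite ler_powR// lerN2.
Qed.

Lemma min_riesz_energy_ge (s delta : R) (n N : nat) :
  0 < s -> 0 < delta -> (n <= N)%N -> ~ packable A delta 'I_n ->
  (((N - n)%:R * delta `^ (- s))%:E <= min_riesz_energy s A N)%E.
Proof.
move=> s0 d0 nN nA; apply: le_ereal_inf_tmp => _ [x [xI Ax] <-].
rewrite lee_fin /riesz_energy.
pose U i := \sum_(j < N | i != j) enorm (x i - x j) `^ (- s).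
have x0 i j : i != j -> 0 < enorm (x i - x j).
  move=> ij; apply: lt_le_trans (norm_le_enorm _).
  by rewrite normr_gt0 subr_eq0 (inj_eq xI).
have Usep i j : i != j -> U i < delta `^ (- s) -> delta < enorm (x i - x j).
  move=> ij Ui.
  have : enorm (x i - x j) `^ (- s) < delta `^ (- s).
    apply: le_lt_trans Ui; rewrite /U (bigD1 j)//= lerDl.
    by rewrite sumr_ge0// => k _; exact: powR_ge0.
  rewrite (powRN (enorm _)) (powRN delta) ltf_pV2 ?posrE ?powR_gt0 ?x0//.
  rewrite !ltNge; apply: contra => h.
  by rewrite ge0_ler_powR ?nnegrE ?enorm_ge0 ?(ltW s0) ?(ltW d0).
pose G := [pred i | U i < delta `^ (- s)].
have Gn : (#|G| < n)%N.
  rewrite ltnNge; apply/negP => nG; apply: nA.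
  apply: (@packable_card _ _ _ _ _ {i | G i}); first by rewrite card_ord card_sig.
  exists (x \o val); split=> [i|i j ij] /=; first exact: Ax.
  by apply: Usep; [rewrite (inj_eq val_inj)|exact: (valP i)].
apply: (@le_trans _ _ (\sum_(i < N | ~~ G i) delta `^ (- s))).
  rewrite sumr_const -[leRHS]mulr_natl ler_wpM2r ?powR_ge0// ler_nat.
  rewrite leq_subLR -[X in (X <= _)%N](card_ord N) -(cardC G).
  by rewrite leq_add// ltnW.
apply: (@le_trans _ _ (\sum_(i < N | ~~ G i) U i)).
  by apply: ler_sum => i; rewrite -leNgt.
rewrite [leRHS](bigID G)/= lerDr; apply: sumr_ge0 => i _.
by apply: sumr_ge0 => j _; exact: powR_ge0.
Qed.

End Energy.

Section NormalizedEnergy.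
Variables (R : realType) (p : nat) (A : set 'rV[R]_p) (d : R).
Hypothesis d0 : 0 < d.

Let powR_normalization (s : R) (N : nat) : (0 < N)%N ->
  N%:R `^ (1 + s / d) = N%:R * (N%:R `^ d^-1) `^ s.
Proof.
move=> N0; rewrite powRD; last by rewrite pnatr_eq0 -lt0n N0 implybT.
by rewrite powRr1// -powRrM mulrC [s / d]mulrC mulrC.
Qed.

Lemma normalized_energy_le (s b : R) (N : nat) :
  (2 * p)%:R <= s -> 0 < b -> (0 < N)%N ->
  (b%:E < best_packing A N * (N%:R `^ d^-1)%:E)%E ->
  (min_riesz_energy s A N / (N%:R `^ (1 + s / d))%:E <=
   (shell_const R p * b `^ (- s))%:E)%E.
Proof.
move=> ps b0 N0; set Z := N%:R `^ d^-1.
have NR0 : 0 < N%:R :> R by rewrite ltr0n.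
have Z0 : 0 < Z by exact: powR_gt0.
rewrite -lte_pdivrMr// -EFinM => /best_packing_gtP.
have bZ : 0 < b / Z by rewrite divr_gt0.
move=> /(_ (ltW bZ))/(min_riesz_energy_le ps bZ) EN.
rewrite powR_normalization// -/Z.
have D0 : 0 < N%:R * Z `^ s by rewrite mulr_gt0 ?powR_gt0.
rewrite inver gt_eqF// lee_pdivrMr//; apply: (le_trans EN).
rewrite -EFinM lee_fin.
have -> : b `^ (- s) = (b / Z) `^ (- s) * Z `^ (- s).
  by rewrite -powRM ?(ltW bZ) ?(ltW Z0)// divfK// gt_eqF.
have /lt0r_neq0 Zs : 0 < Z `^ s by exact: powR_gt0.
rewrite (powRN Z) le_eqVlt; apply/orP; left; apply/eqP; field.
by [].
Qed.

Lemma normalized_energy_ge (s a : R) (q n : nat) :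
  0 < s -> 0 < a -> (0 < q)%N -> (q <= n)%N ->
  (best_packing A n * (n%:R `^ d^-1)%:E < a%:E)%E ->
  (((4 * q)%:R^-1 * ((1 + q%:R^-1) `^ d^-1 * a) `^ (- s))%:E <=
   min_riesz_energy s A (n + n %/ q) /
     ((n + n %/ q)%:R `^ (1 + s / d))%:E)%E.
Proof.
move=> s0 a0 q0 qn; set N := (n + n %/ q)%N.
have n0 : (0 < n)%N by exact: leq_trans qn.
have N0 : (0 < N)%N by rewrite /N addn_gt0 n0.
have nR0 : 0 < n%:R :> R by rewrite ltr0n.
have NR0 : 0 < N%:R :> R by rewrite ltr0n.
have qR0 : 0 < q%:R :> R by rewrite ltr0n.
have NnR : N%:R <= (1 + q%:R^-1) * n%:R :> R.
  rewrite /N natrD mulrDl mul1r lerD2l// mulrC ler_pdivlMr// -natrM ler_nat.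
  exact: leq_trunc_div.
have N4 : N%:R <= (4 * q)%:R * (n %/ q)%:R :> R.
  rewrite -natrM ler_nat.
  have nq := ltn_ceil n q0.
  have nq0 : (0 < n %/ q)%N by rewrite divn_gt0.
  rewrite -mulnA [(q * _)%N]mulnC /N; move: nq nq0; rewrite mulSn.
  move: (n %/ q)%N => t nq t0; have qt := leq_pmull q t0.
  have -> : (4 * (t * q) = t * q + t * q + t * q + t * q)%N.
    by rewrite !mulSn mul0n addn0 !addnA.
  apply: leq_trans (leq_addr _ _); apply: leq_add; last exact: leq_pmulr.
  by apply: leq_trans (ltnW nq) _; rewrite leq_add2r.
set Z := n%:R `^ d^-1.
have Z0 : 0 < Z by exact: powR_gt0.
rewrite -lte_pdivlMr// -EFinM => aZ.
have dl0 : 0 < a / Z by rewrite divr_gt0.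
have npack : ~ packable A (a / Z) 'I_n.
  by move=> /(best_packing_gtP _ _ (ltW dl0)); rewrite ltNge (ltW aZ).
have := min_riesz_energy_ge s0 dl0 (leq_addr (n %/ q) n) npack.
rewrite -/N {1}/N addKn => EN.
rewrite powR_normalization//.
set lam := (1 + q%:R^-1) `^ d^-1.
set Y := N%:R `^ d^-1.
have qV0 : 0 < 1 + q%:R^-1 :> R by rewrite addr_gt0// invr_gt0.
have lam0 : 0 < lam by exact: powR_gt0.
have Y0 : 0 < Y by exact: powR_gt0.
have YZ : Y * (a / Z) <= lam * a.
  rewrite mulrCA mulrC ler_pM2r// ler_pdivrMr//.
  rewrite /Y /lam /Z -powRM ?(ltW qV0)//.
  by rewrite ge0_ler_powR ?nnegrE ?invr_ge0 ?mulr_ge0 ?(ltW d0) ?(ltW qV0).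
have D0 : 0 < N%:R * Y `^ s by rewrite mulr_gt0 ?powR_gt0.
rewrite inver gt_eqF// lee_pdivlMr//; apply: le_trans EN.
rewrite -EFinM lee_fin.
rewrite mulrACA; apply: ler_pM.
- by rewrite mulr_ge0// invr_ge0.
- by rewrite mulr_ge0// powR_ge0.
- by rewrite mulrC ler_pdivrMr ?ltr0n ?muln_gt0// mulrC.
have H : Y `^ s * (a / Z) `^ s <= (lam * a) `^ s.
  rewrite -powRM ?(ltW Y0) ?(ltW dl0)//.
  by rewrite ge0_ler_powR ?nnegrE ?(ltW s0)// mulr_ge0// ltW.
rewrite (powRN (lam * a)) (powRN (a / Z)).
rewrite mulrC ler_pdivrMr ?powR_gt0 ?mulr_gt0//.
by rewrite ler_pdivlMl ?powR_gt0// [leLHS]mulrC.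
Qed.

End NormalizedEnergy.

Lemma energy_no_limit (R : realType) (p : nat) (A : set 'rV[R]_p) (d a b : R) :
  0 < d -> 0 < a -> a < b ->
  (forall n, exists2 N, (n <= N)%N &
    (best_packing A N * (N%:R `^ d^-1)%:E < a%:E)%E) ->
  (forall n, exists2 N, (n <= N)%N &
    (b%:E < best_packing A N * (N%:R `^ d^-1)%:E)%E) ->
  exists s0 : R, forall s : R, s0 <= s ->
    ~ cvg ((min_riesz_energy s A N / (N%:R `^ (1 + s / d))%:E)%E @[N --> \oo]).
Proof.
move=> d0 a0 ab Ha Hb; have b0 : 0 < b by exact: lt_trans ab.
have ad0 : 0 < a `^ d by exact: powR_gt0.
have abd : a `^ d < b `^ d by rewrite gt0_ltr_powR ?nnegrE ?(ltW a0) ?(ltW b0).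
have [q q0 qE] : exists2 q : nat, (0 < q)%N & (1 + q%:R^-1) * a `^ d < b `^ d.
  have bad0 : 0 < b `^ d - a `^ d by rewrite subr_gt0.
  exists (Num.truncn (a `^ d / (b `^ d - a `^ d))).+1 => //.
  rewrite mulrDl mul1r -ltrBrDl mulrC ltr_pdivrMr// mulrC -ltr_pdivrMr//.
  exact: truncnS_gt.
pose a' := (1 + q%:R^-1) `^ d^-1 * a.
have qV0 : 0 < 1 + q%:R^-1 :> R by rewrite addr_gt0// invr_gt0 ltr0n.
have a'0 : 0 < a' by rewrite mulr_gt0 ?powR_gt0.
have a'b : a' < b.
  have -> : b = (b `^ d) `^ d^-1 by rewrite -powRrM mulfV ?gt_eqF// powRr1// ltW.
  have -> : a' = ((1 + q%:R^-1) * a `^ d) `^ d^-1.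
    by rewrite powRM ?(ltW qV0) ?powR_ge0// -powRrM mulfV ?gt_eqF// powRr1// ltW.
  by rewrite gt0_ltr_powR ?invr_gt0 ?nnegrE ?powR_ge0// mulr_ge0 ?(ltW qV0) ?powR_ge0.
have t1 : 1 < b / a' by rewrite ltr_pdivlMr// mul1r.
have lt0 : 0 < ln (b / a') by exact: ln_gt0.
pose K := (4 * q)%:R * shell_const R p.
have K0 : 0 <= K by rewrite mulr_ge0// shell_const_ge0.
exists ((2 * p)%:R + K / ln (b / a') + 1) => s hs.
have Kl0 : 0 <= K / ln (b / a') by rewrite divr_ge0// ltW.
have p0 : (0 : R) <= (2 * p)%:R by [].
have s0 : 0 < s by lra.
have ps : (2 * p)%:R <= s by lra.
have Ks : K / ln (b / a') <= s by lra.
move=> /cvg_ex[g]; set W := (X in X @ _ --> _) => Wg.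
have gle : (g <= (shell_const R p * b `^ (- s))%:E)%E.
  apply: cvge_frequently_le Wg _ => n; have [N nN bN] := Hb n.+1.
  exists N; first exact: ltnW.
  by apply: normalized_energy_le => //; exact: leq_ltn_trans nN.
have gge : (((4 * q)%:R^-1 * a' `^ (- s))%:E <= g)%E.
  apply: cvge_frequently_ge Wg _ => n; have [N nN aN] := Ha (n + q)%N.
  exists (N + N %/ q)%N.
    by rewrite (leq_trans _ (leq_addr _ _))// (leq_trans _ nN)// leq_addr.
  by apply: normalized_energy_ge => //; rewrite (leq_trans _ nN)// leq_addl.
have := le_trans gge gle; rewrite lee_fin; apply/negP; rewrite -ltNge.
have ba0 : 0 < b / a' by exact: lt_trans t1.
have key : K < (b / a') `^ s.
  rewrite /powR gt_eqF//; apply: lt_le_trans (expR_ge1Dx _).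
  by move: Ks; rewrite ler_pdivrMr// => Ks; rewrite ltr_pwDl.
have bE : b `^ s = (b / a') `^ s * a' `^ s.
  by rewrite -powRM ?(ltW ba0) ?(ltW a'0)// divfK// gt_eqF.
have a's0 : 0 < a' `^ s by exact: powR_gt0.
have q40 : 0 < (4 * q)%:R :> R by rewrite ltr0n muln_gt0.
rewrite (powRN a') (powRN b) ltr_pdivrMr ?powR_gt0//.
by rewrite bE mulrACA mulVf ?mulr1 ?gt_eqF// ltr_pdivlMl.
Qed.

Lemma best_packing_ge0 (R : realType) (p M : nat)
    (psi : 'I_M -> 'rV[R]_p -> 'rV[R]_p) (rs : 'I_M -> R)
    (A : set 'rV[R]_p) (r : R) (i : 'I_M -> nat) (N : nat) :
  self_similar_fractal psi rs A ->
  0 < r < 1 -> (forall k, rs k = r ^+ i k) ->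
  (0 <= best_packing A N)%E.
Proof.
move=> hA hr hrs.
have [_ _ [_ cA] _ _] := hA; have r0 : 0 < r by case/andP: hr.
have [h h0 hP] := self_similar_packing_recurrence hA.
have hh : 0 < h / 2 < h by lra.
have := packing_number_geometric_ge hA hr hrs hP hh (leqnn (N * \max_m i m)).
set delta := _ * (h / 2) => Ndelta.
have delta0 : 0 < delta by rewrite mulr_gt0 ?exprn_gt0//; case/andP: hh.
apply: (@le_trans _ _ delta%:E); first by rewrite lee_fin ltW.
apply/ltW/best_packing_gtP; first exact: ltW.
by apply/(packing_numberP cA _ delta0); rewrite card_ord.
Qed.

Theorem theorem4p2 (R : realType) (p M : nat)
    (psi : 'I_M -> 'rV[R]_p -> 'rV[R]_p) (rs : 'I_M -> R)
    (A : set 'rV[R]_p) (d : R)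
    (hA : self_similar_fractal psi rs A)
    (hd : similarity_dimension rs d)
    (r : R) (hr : 0 < r < 1)
    (i : 'I_M -> nat) (hi : forall k, (0 < i k)%N)
    (hrs : forall k, rs k = r ^+ i k) :
  ~ cvg ((best_packing A N * (N%:R `^ d^-1)%:E)%E @[N --> \oo]) /\
  exists s0 : R, forall s : R, s0 <= s ->
    ~ cvg ((min_riesz_energy s A N / (N%:R `^ (1 + s / d))%:E)%E @[N --> \oo]).
Proof.
have nocvg := packing_no_limit hA hd hr hi hrs; split=> //.
have [N|a [b [a0 ab Ha Hb]]] := not_cvg_oscillates _ nocvg.
  by rewrite mule_ge0 ?lee_fin ?powR_ge0// (best_packing_ge0 _ hA hr hrs).
exact: energy_no_limit (similarity_dimension_gt0 hA hd) a0 ab Ha Hb.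
Qed.
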